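(* Let $\theta^0,\theta^\infty_1,\theta^\infty_2,\theta^\infty_3\in\mathbb{C}$ with $2\theta^0+2\theta^\infty_1+\theta^\infty_2+\theta^\infty_3=0$ and $\theta^\infty_1,\theta^\infty_2,\theta^\infty_3$ pairwise distinct. Let $q_1,p_1,q_2,p_2,v$ be holomorphic functions of $t$ and $U$ a holomorphic $2\times2$-matrix function of $t$ on a domain of $\mathbb{C}$, with $v\ne0$ and $\det U\neq0$. Put $$Q=\begin{pmatrix} q_1&1\\-q_2&q_1\end{pmatrix},\quad P=\begin{pmatrix} p_1/2&-p_2\\ p_2q_2-\theta^0-\theta^\infty_1-\theta^\infty_2&p_1/2\end{pmatrix},\quad \Theta=\begin{pmatrix}\theta^\infty_2&0\\0&\theta^\infty_3\end{pmatrix},\quad G=U\oplus\mathrm{diag}(v,1),$$ $$Z=(\theta^\infty_1-\Theta)^{-1}\left[(P-Q-t)Q-\theta^0-\theta^\infty_1\right],$$ and in $2\times2$ blocks (scalars meaning multiples of $I=I_2$) $$\hat A_0^{(-2)}=\begin{pmatrix}I\\-Z\end{pmatrix}\begin{pmatrix}-I-Z&-I\end{pmatrix},\quad \hat A_0^{(-1)}=\begin{pmatrix}PZ+Q+t&P\\-ZPZ-QZ-ZQ-tZ-Q&-ZP-Q\end{pmatrix},\quad \hat A_0^{(0)}=-\begin{pmatrix}\theta^\infty_1I&O\\O&\Theta\end{pmatrix}.$$ Consider the linear systems $$\frac{\partial Y}{\partial x}=AY,\quad A=G^{-1}\left(\frac{\hat A_0^{(-2)}}{x^3}+\frac{\hat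 A_0^{(-1)}}{x^2}+\frac{\hat A_0^{(0)}}{x}\right)G,\qquad \frac{\partial Y}{\partial t}=BY,\quad B=\frac1x\,G^{-1}\hat A_0^{(-2)}G .$$ Then the compatibility condition $\partial_tA-\partial_xB+[A,B]=O$ (for all $x$) is equivalent to the Hamiltonian system $$\frac{dq_i}{dt}=\frac{\partial H}{\partial p_i},\quad \frac{dp_i}{dt}=-\frac{\partial H}{\partial q_i}\ (i=1,2),\qquad H=\mathrm{tr}\left[PQ(P-Q-t)-(\theta^0+\theta^\infty_1)P+(\theta^0+2\theta^\infty_1-1)Q\right],$$ together with $$\frac{dU}{dt}=\begin{pmatrix}-\frac32p_1+2(p_2+2)q_1+2t&p_2+2\\-(p_2+2)q_2+\theta^0+\theta^\infty_1+\theta^\infty_2&2q_1+t-\frac{p_1}2\end{pmatrix}U,\qquad \frac1v\frac{dv}{dt}=2(p_2+1)q_1-p_1+t .$$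
   Context: This is the fourth matrix Painlevé system $H^{\mathrm{Mat}}_{\mathrm{IV}}$, attached to linear systems with an irregular singularity at $x=0$ and a regular singularity at $x=\infty$, of spectral type $((2))((2)),211$. $H$ is regarded as a polynomial in $q_1,p_1,q_2,p_2,t$ by inserting the displayed matrices. $\oplus$ denotes block-diagonal sum. *)

(* Defs.v *)
From HB Require Import structures.
From mathcomp Require Import all_boot all_order all_algebra.
From mathcomp Require Import complex.
From mathcomp Require Import all_classical all_reals all_analysis.

Set Implicit Arguments.
Unset Strict Implicit.
Unset Printing Implicit Defensive.

Import Order.TTheory GRing.Theory Num.Theory.
Import numFieldNormedType.Exports.

Local Open Scope classical_set_scope.
Local Open Scope ring_scope.
Local Open Scope complex_scope.

Definition mx2 (F : fieldType) (a b c d : F) : 'M[F]_2 :=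
  \matrix_(i < 2, j < 2)
    if i == 0 then (if j == 0 then a else b) else (if j == 0 then c else d).

Definition Qmx (F : fieldType) (q1 q2 : F) : 'M[F]_2 := mx2 q1 1 (- q2) q1.

Definition Pmx (F : fieldType) (th0 th1 th2 p1 p2 q2 : F) : 'M[F]_2 :=
  mx2 (p1 / 2) (- p2) (p2 * q2 - th0 - th1 - th2) (p1 / 2).

Definition Thmx (F : fieldType) (th2 th3 : F) : 'M[F]_2 := mx2 th2 0 0 th3.

Definition Zmx (F : fieldType) (th0 th1 : F) (Th Q P : 'M[F]_2) (t : F) :
    'M[F]_2 :=
  invmx (th1%:M - Th) *m ((P - Q - t%:M) *m Q - th0%:M - th1%:M).

Definition hatA2 (F : fieldType) (Z : 'M[F]_2) : 'M[F]_(2 + 2) :=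
  col_mx 1%:M (- Z) *m row_mx (- 1%:M - Z) (- 1%:M).

Definition hatA1 (F : fieldType) (Q P Z : 'M[F]_2) (t : F) : 'M[F]_(2 + 2) :=
  block_mx
    (P *m Z + Q + t%:M) P
    (- (Z *m P *m Z) - Q *m Z - Z *m Q - t *: Z - Q) (- (Z *m P) - Q).

Definition hatA0 (F : fieldType) (th1 : F) (Th : 'M[F]_2) : 'M[F]_(2 + 2) :=
  - block_mx th1%:M 0 0 Th.

Definition Gmx (F : fieldType) (U : 'M[F]_2) (v : F) : 'M[F]_(2 + 2) :=
  block_mx U 0 0 (mx2 v 0 0 1).

Definition Amx (F : fieldType) (th0 th1 th2 th3 q1 p1 q2 p2 v : F)
    (U : 'M[F]_2) (x t : F) : 'M[F]_(2 + 2) :=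
  let Q := Qmx q1 q2 in
  let P := Pmx th0 th1 th2 p1 p2 q2 in
  let Th := Thmx th2 th3 in
  let Z := Zmx th0 th1 Th Q P t in
  let G := Gmx U v in
  invmx G
    *m ((x ^+ 3)^-1 *: hatA2 Z + (x ^+ 2)^-1 *: hatA1 Q P Z t
        + x^-1 *: hatA0 th1 Th)
    *m G.

Definition Bmx (F : fieldType) (th0 th1 th2 th3 q1 p1 q2 p2 v : F)
    (U : 'M[F]_2) (x t : F) : 'M[F]_(2 + 2) :=
  let Q := Qmx q1 q2 in
  let P := Pmx th0 th1 th2 p1 p2 q2 in
  let Z := Zmx th0 th1 (Thmx th2 th3) Q P t in
  let G := Gmx U v in
  x^-1 *: (invmx G *m hatA2 Z *m G).

Definition Ham (F : fieldType) (th0 th1 th2 q1 p1 q2 p2 t : F) : F :=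
  let Q := Qmx q1 q2 in
  let P := Pmx th0 th1 th2 p1 p2 q2 in
  \tr (P *m Q *m (P - Q - t%:M) - (th0 + th1) *: P
       + (th0 + 2 * th1 - 1) *: Q).

Definition Umx (F : fieldType) (th0 th1 th2 q1 p1 q2 p2 t : F) : 'M[F]_2 :=
  mx2 (- (3 / 2) * p1 + 2 * (p2 + 2) * q1 + 2 * t) (p2 + 2)
      (- (p2 + 2) * q2 + th0 + th1 + th2) (2 * q1 + t - p1 / 2).

(* R[i] as a numFieldType: this gives it the topology and the normed-space
   structure over itself, so that derivable and derive1 below are complex
   differentiability and the complex derivative. *)
Definition Cplx (R : realType) : numFieldType := R[i].

(* Meant for an open D, where this is holomorphy; V is Cplx R or a space of
   matrices over it. *)
Definition holomorphic_on (R : realType) (V : normedModType (Cplx R))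
    (D : set (Cplx R)) (f : Cplx R -> V) :=
  forall t : Cplx R, D t -> derivable f t 1.

Definition zero_curvature (R : realType) (n : nat)
    (A B : Cplx R -> Cplx R -> 'M[Cplx R]_n) (x t : Cplx R) : 'M[Cplx R]_n :=
  derive1 (fun s : Cplx R => A x s) t - derive1 (fun y : Cplx R => B y t) x
    + (A x t *m B x t - B x t *m A x t).

(* Main.v *)
Require Import Defs.
From HB Require Import structures.
From mathcomp Require Import all_boot all_order all_algebra.
From mathcomp Require Import perm complex.
From mathcomp Require Import all_classical all_reals all_analysis.
From mathcomp Require Import ring.

Set Implicit Arguments.
Unset Strict Implicit.
Unset Printing Implicit Defensive.

Import Order.TTheory GRing.Theory Num.Theory.
Import numFieldNormedType.Exports.

Local Open Scope classical_set_scope.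
Local Open Scope ring_scope.

(** The whole system becomes elementary in the gauge of the lower triangular
    matrix [shear Z], with blocks I, 0, Z, I: there the coefficients of x^-3,
    x^-2 and x^-1 of the hatted matrix are
<<
      / -I  -I \    / Q+t   P \      / th1   0 \
      \  0   0 /,   \ -Q   -Q /,   - \  S    Th /,   S = (P-Q-t)Q - th0 - th1,
>>
    so Z survives only through S = (th1 - Th) Z ([shear_hatA2], [shear_hatA1],
    [shear_hatA0]). Put Gam = shear Z * G. Writing Gam' = X Gam, the curvature
    is the conjugate by Gam of a Laurent polynomial in x with the three
    coefficients of [curvature_conj], and it vanishes for all x iff these do
    ([laurent_eq0]).

    The matrix X is block triangular, with diagonal blocks W1 = U' U^-1 and
    W2 = diag(v'/v, 0) and a corner K determined by
    (th1 - Th) K = S' + S W1 - W2 S. As Th commutes with W2, that relation is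
    exactly the vanishing of the x^-1 coefficient ([reduced_residue]). The other
    two coefficients vanish iff ([reduced_curvature])
<<
      K = -Q,    W1 = W2 + 2 Q + t - P,
      P' = [W2, P] + (2 Q + t - P) P + 1 - th1 + Th,
      Q' = [W2, Q] + Q P + S,
>>
    and K = -Q follows from the rest by the formula for K ([reduced_corner]).
    These three lemmas hold for blocks of any size.

    It remains to read the matrix equations entrywise for the given 2 x 2
    matrices ([hamiltonian_form]). As the upper right entry of Q is the
    constant 1, the corresponding entry of the equation for Q' fixes v'/v; the
    two diagonal entries of the equation for P' agree because of the Fuchs
    relation; the remaining entries are Hamilton's equations. Then the
    equation for W1 is the one for U' ([Umx_gauge]). *)

(** * Derivatives of matrix-valued functions *)

Section MatrixCalculus.
Variables (K : numFieldType) (V : normedModType K).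

Lemma is_derive_cvgP (W : normedModType K) (f : V -> W) (x v : V) (l : W) :
  is_derive x v f l <-> h^-1 *: (f (h *: v + x) - f x) @[h --> 0^'] --> l.
Proof.
split=> [[fd <-]|fl]; first exact: fd.
by apply: DeriveDef; [exact: cvgP fl|exact: cvg_lim fl].
Qed.

(** Basic neighbourhoods in a space of matrices are products of neighbourhoods
    of the finitely many entries. *)
Lemma cvg_mxP T (F : set_system T) (FF : Filter F) m n (f : T -> 'M[K]_(m, n))
    (M : 'M[K]_(m, n)) :
  (f @ F --> M) <-> (forall i j, (fun y => f y i j) @ F --> M i j).
Proof.
split=> [fM i j|fM A [P MP sPA]].
  exact: (@cvg_comp _ _ _ f (fun N : 'M[K]_(m, n) => N i j) _ _ _ fM
    (@coord_continuous K m n i j M)).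
apply: filterS sPA _; rewrite /nbhs /=.
by do 2 apply: filter_forall => ?; exact/fM/MP.
Qed.

Lemma is_derive_mxP m n (M : V -> 'M[K]_(m, n)) (x v : V) (dM : 'M[K]_(m, n)) :
  is_derive x v M dM <->
  forall i j, is_derive x v (fun y => M y i j) (dM i j).
Proof.
rewrite is_derive_cvgP cvg_mxP.
have entE i j : (fun h => (h^-1 *: (M (h *: v + x) - M x)) i j) =
    (fun h => h^-1 *: (M (h *: v + x) i j - M x i j)).
  by apply/funext => h; rewrite !mxE.
by split=> H i j; have := H i j; rewrite is_derive_cvgP entE.
Qed.

Lemma is_derive_mulmx m n p (M : V -> 'M[K]_(m, n)) (N : V -> 'M[K]_(n, p))
    (x v : V) dM dN :
  is_derive x v M dM -> is_derive x v N dN ->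
  is_derive x v (fun y => M y *m N y) (dM *m N x + M x *m dN).
Proof.
move=> /is_derive_mxP MdM /is_derive_mxP NdN; apply/is_derive_mxP => i j.
rewrite !mxE -big_split /=.
rewrite (_ : (fun y => _) = \sum_k ((fun y => M y i k) * (fun y => N y k j)));
  last by apply/funext => y; rewrite mxE fct_sumE.
apply: is_derive_sum => k.
apply: (is_derive_eq (is_deriveM (MdM i k) (NdN k j))).
by rewrite /GRing.scale /= addrC; congr (_ + _); rewrite mulrC.
Qed.

Lemma is_derive_block m1 m2 n1 n2 (M11 : V -> 'M[K]_(m1, n1)) M12 M21
    (M22 : V -> 'M[K]_(m2, n2)) (x v : V) d11 d12 d21 d22 :
  is_derive x v M11 d11 -> is_derive x v M12 d12 ->
  is_derive x v M21 d21 -> is_derive x v M22 d22 ->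
  is_derive x v (fun y => block_mx (M11 y) (M12 y) (M21 y) (M22 y))
    (block_mx d11 d12 d21 d22).
Proof.
move=> /is_derive_mxP D11 /is_derive_mxP D12.
move=> /is_derive_mxP D21 /is_derive_mxP D22.
apply/is_derive_mxP => i j.
case: (split_ordP i) => i' ->; case: (split_ordP j) => j' ->;
  rewrite ?(block_mxEul, block_mxEur, block_mxEdl, block_mxEdr);
  by under eq_fun do
    rewrite ?(block_mxEul, block_mxEur, block_mxEdl, block_mxEdr).
Qed.

Lemma derivable_prod (I : Type) (r : seq I) (f : I -> V -> K) (x v : V) :
  (forall i, derivable (f i) x v) ->
  derivable (fun y => \prod_(i <- r) f i y) x v.
Proof.
move=> fd; elim: r => [|i r IHr].
  by under eq_fun do rewrite big_nil; exact: derivable_cst.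
by under eq_fun do rewrite big_cons; exact: derivableM.
Qed.

Lemma derivable_det n (M : V -> 'M[K]_n) (x v : V) :
  (forall i j, derivable (fun y => M y i j) x v) ->
  derivable (fun y => \det (M y)) x v.
Proof.
move=> Md; rewrite /determinant.
rewrite (_ : (fun y => _) = \sum_(s : 'S_n)
    (fun y => (-1) ^+ s * \prod_i M y i (s i)));
  last by apply/funext => y; rewrite fct_sumE.
elim/big_ind : _ => [|f g|s _]; [exact: derivable_cst|exact: derivableD|].
by apply: derivableM; [exact: derivable_cst|exact: derivable_prod].
Qed.

End MatrixCalculus.

Section Inverse.
Variable K : numFieldType.

Lemma is_derive_invmx n (M : K -> 'M[K]_n) (x : K) dM :
  is_derive x 1 M dM -> M x \in unitmx ->
  is_derive x 1 (fun y => invmx (M y)) (- (invmx (M x) *m dM *m invmx (M x))).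
Proof.
move=> dMx ux.
have Md i j : derivable (fun y => M y i j) x 1.
  by move/is_derive_mxP : (dMx) => /(_ i j) [].
have detd := derivable_det Md.
have nu : \forall y \near x, M y \in unitmx.
  have : \det (M x) != 0 by move: ux; rewrite unitmxE unitfE.
  have /cvgr_neq0 : {for x, continuous (fun y => \det (M y))}.
    exact/differentiable_continuous/derivable1_diffP.
  by move=> /[apply]; apply: filterS => y; rewrite unitmxE unitfE.
(* Cramer's rule shows that the inverse is differentiable; the value of its
   derivative then comes from differentiating M^-1 M = 1. *)
have invd : exists dI, is_derive x 1 (fun y => invmx (M y)) dI.
  exists (\matrix_(i, j)
    'D_1 (fun y => (\det (M y))^-1 * cofactor (M y) j i) x).
  apply: (near_eq_is_derive (f := fun y => (\det (M y))^-1 *: \adj (M y))).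
    by apply: filterS nu => y uy; rewrite /invmx uy.
  apply/is_derive_mxP => i j; rewrite mxE; under eq_fun do rewrite !mxE.
  apply/derivableP/derivableM.
    by apply: derivableV => //; rewrite -unitfE -unitmxE.
  apply: derivableM; first exact: derivable_cst.
  by apply: derivable_det => k l; under eq_fun do rewrite !mxE; exact: Md.
have [dI dIx] := invd.
have [_ prodE] := is_derive_mulmx dIx dMx.
have [_ oneE] : is_derive x 1 (fun y => invmx (M y) *m M y) 0.
  apply: (near_eq_is_derive (f := cst 1%:M)).
  by apply: filterS nu => y uy; rewrite mulVmx.
apply: (is_derive_eq dIx); rewrite -[LHS](mulmxK ux) -mulNmx.
by congr (_ *m _); apply/eqP; rewrite -addr_eq0 -prodE oneE.
Qed.
End Inverse.

(** * The system in a reduced gauge *)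

(* Expands a matrix expression into a linear combination of noncommutative
   monomials. *)
Ltac mx_expand :=
  rewrite ?(mulmxDl, mulmxDr, mulNmx, mulmxN, opprD, opprK, mulmx1, mul1mx,
    mulmx0, mul0mx, mul_scalar_mx, mul_mx_scalar, scalerDr, scalerN, mulmxA,
    =^~ scalemxAl, =^~ scalemxAr).

(* Proves identities between noncommutative polynomials in matrices: after
   expansion, the entry (i, j) of each monomial is an atom for [ring], so the
   products of matrices are never evaluated. *)
Ltac mx_ring :=
  let i := fresh "i" in let j := fresh "j" in
  mx_expand; apply/matrixP => i j;
  do ?[rewrite [(_ + _ : 'M[_]_(_, _)) i j]mxE
      |rewrite [(- _ : 'M[_]_(_, _)) i j]mxE
      |rewrite [(_ *: _ : 'M[_]_(_, _)) i j]mxE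
      |rewrite [(0 : 'M[_]_(_, _)) i j]mxE
      |rewrite [(_%:M : 'M[_]_(_, _)) i j]mxE];
  ring.

Definition lie (F : fieldType) n (A B : 'M[F]_n) : 'M[F]_n :=
  A *m B - B *m A.

Section ReducedGauge.
Variables (F : fieldType) (n : nat).
Implicit Types (P Q Z S Th W : 'M[F]_n) (t c th : F).

Definition shear Z : 'M[F]_(n + n) := block_mx 1%:M 0 Z 1%:M.

(** [redA2], [redA1] and [redA0] are the conjugates by [shear Z] of the
    coefficients of x^-3, x^-2 and x^-1 of the hatted matrix, with S standing
    for (th1 - Th) Z. *)
Definition redA2 : 'M[F]_(n + n) := block_mx (- 1%:M) (- 1%:M) 0 0.

Definition redA1 Q P t : 'M[F]_(n + n) := block_mx (Q + t%:M) P (- Q) (- Q).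

Definition redA0 th1 Th S : 'M[F]_(n + n) := - block_mx th1%:M 0 S Th.

Lemma block_mx_eq0 (a b c d : 'M[F]_n) :
  block_mx a b c d = 0 <-> [/\ a = 0, b = 0, c = 0 & d = 0].
Proof.
split=> [|[-> -> -> ->]]; last by rewrite block_mx0.
by rewrite -[RHS]block_mx0 => /eq_block_mx.
Qed.

(** The x^-1 coefficient of the curvature is the relation between the corner
    K of the connection matrix and S; it vanishes identically because the
    x^-1 coefficient of the hatted matrix is constant and commutes with the
    block-diagonal matrix of W1 and W2. *)
Lemma reduced_residue S dS Th W1 W2 K th1 :
  Th *m W2 = W2 *m Th ->
  (th1%:M - Th) *m K = dS + S *m W1 - W2 *m S ->
  block_mx 0 0 (- dS) 0 + lie (redA0 th1 Th S) (block_mx W1 0 K W2) = 0.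
Proof.
move=> cW hK; have dSE : dS = (th1%:M - Th) *m K - S *m W1 + W2 *m S.
  by rewrite hK; mx_ring.
rewrite /lie /redA0 opp_block_mx !mulmx_block opp_block_mx !add_block_mx.
apply/block_mx_eq0; split; rewrite ?dSE; mx_expand; rewrite -?cW; mx_ring.
Qed.

(** The x^-3 coefficient gives K and W1; the upper right block of the x^-2
    coefficient is then the equation for dP, and its other three blocks all
    reduce to the equation for dQ. *)
Lemma reduced_curvature P Q S Th W1 W2 dP dQ K t th1 :
  let X := block_mx W1 0 K W2 in
  (lie redA2 X + lie (redA1 Q P t) redA2 = 0 /\
   block_mx (dQ + 1%:M) dP (- dQ) (- dQ) + lie (redA1 Q P t) X + redA2
     + lie (redA0 th1 Th S) redA2 = 0)
  <->
  [/\ K = - Q, W1 = W2 + 2 *: Q + t%:M - P,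
      dP = lie W2 P + (2 *: Q + t%:M - P) *m P + (1 - th1)%:M + Th &
      dQ = lie W2 Q + Q *m P + S].
Proof.
rewrite /= /lie /redA2 /redA1 /redA0 !opp_block_mx !mulmx_block.
rewrite !opp_block_mx !add_block_mx !block_mx_eq0.
split=> [[[e11 e12 _ _] [_ f12 _ f22]]|[-> -> -> ->]]; last first.
  by split; split; mx_ring.
have KE : K = - Q.
  by apply: subr0_eq; rewrite -[RHS]oppr0 -[in RHS]e11; mx_ring.
have W1E : W1 = W2 + 2 *: Q + t%:M - P.
  by apply: subr0_eq; rewrite -[RHS]e12; mx_ring.
split=> //; apply: subr0_eq.
  by rewrite -[RHS]f12 W1E; mx_ring.
by rewrite -[RHS]oppr0 -[in RHS]f22 KE; mx_ring.
Qed.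

(** The equations for W1, dP and dQ imply the remaining one: they turn
    dS + S W1 - W2 S into - (th1 - Th) Q, by an identity between noncommutative
    polynomials modulo the relation between W2 and Th. *)
Lemma reduced_corner P Q S dS Th W1 W2 dP dQ K t c th1 :
  th1%:M - Th \in unitmx -> Th *m W2 = W2 *m Th ->
  (th1%:M - Th) *m K = dS + S *m W1 - W2 *m S ->
  S = (P - Q - t%:M) *m Q - c%:M ->
  dS = (dP - dQ - 1%:M) *m Q + (P - Q - t%:M) *m dQ ->
  W1 = W2 + 2 *: Q + t%:M - P ->
  dP = lie W2 P + (2 *: Q + t%:M - P) *m P + (1 - th1)%:M + Th ->
  dQ = lie W2 Q + Q *m P + S ->
  K = - Q.
Proof.
move=> uT cW hK SE dSE W1E dPE dQE.
rewrite -[LHS](mulKmx uT) -[RHS](mulKmx uT); congr (_ *m _).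
rewrite hK dSE dPE dQE W1E SE /lie; mx_ring.
Qed.
End ReducedGauge.

Section HatToReduced.
Variable F : fieldType.

Lemma shear_hatA2 (Z : 'M[F]_2) : shear Z *m hatA2 Z = redA2 F 2 *m shear Z.
Proof.
rewrite /shear /hatA2 mul_col_row /redA2 !mulmx_block.
by congr block_mx; mx_ring.
Qed.

Lemma shear_hatA1 (Q P Z : 'M[F]_2) (t : F) :
  shear Z *m hatA1 Q P Z t = redA1 Q P t *m shear Z.
Proof.
by rewrite /shear /hatA1 /redA1 !mulmx_block; congr block_mx; mx_ring.
Qed.

Lemma shear_hatA0 (Th Z S : 'M[F]_2) (th1 : F) :
  (th1%:M - Th) *m Z = S ->
  shear Z *m hatA0 th1 Th = redA0 th1 Th S *m shear Z.
Proof.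
move=> <-; rewrite /shear /hatA0 /redA0 !opp_block_mx !mulmx_block.
by congr block_mx; mx_ring.
Qed.
End HatToReduced.

(** * The curvature in a moving frame *)

Section Curvature.
Variable K : numFieldType.

(** Conjugation by a moving frame Gam with Gam' = X Gam turns the derivative
    into the covariant derivative dM + [M, X]. *)
Lemma is_derive_conj n (Gam M : K -> 'M[K]_n) (X dM : 'M[K]_n) (t : K) :
  is_derive t 1 Gam (X *m Gam t) -> is_derive t 1 M dM -> Gam t \in unitmx ->
  is_derive t 1 (fun s => invmx (Gam s) *m M s *m Gam s)
    (invmx (Gam t) *m (dM + lie (M t) X) *m Gam t).
Proof.
move=> dG dMt uG.
have := is_derive_mulmx (is_derive_mulmx (is_derive_invmx dG uG) dMt) dG.
move=> /is_derive_eq; apply.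
have -> : invmx (Gam t) *m (X *m Gam t) *m invmx (Gam t) = invmx (Gam t) *m X.
  by rewrite mulmxA mulmxK.
by rewrite /lie; mx_ring.
Qed.

Lemma is_derive_scalemx m n (f : K -> K) (M : 'M[K]_(m, n)) (x df : K) :
  is_derive x 1 f df -> is_derive x 1 (fun y => f y *: M) (df *: M).
Proof.
move=> fdf; apply/is_derive_mxP => i j; rewrite mxE.
rewrite (_ : (fun y => _) = f * cst (M i j)); last first.
  by apply/funext => y; rewrite mxE.
apply: (is_derive_eq (is_deriveM fdf (is_derive_cst (M i j) x 1))).
by rewrite scaler0 add0r /GRing.scale /= mulrC.
Qed.

Lemma is_derive_inv (x : K) : x != 0 ->
  is_derive x 1 (fun y : K => y^-1) (- x ^- 2).
Proof.
move=> x0; apply: DeriveDef; first exact: derivableV.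
by rewrite deriveV // derive_id /GRing.scale /= mulr1.
Qed.

(** The three points 1, -1 and 2 suffice. *)
Lemma laurent_eq0 m n (C3 C2 C1 : 'M[K]_(m, n)) :
  (forall x : K, x != 0 ->
     (x ^+ 3)^-1 *: C3 + (x ^+ 2)^-1 *: C2 + x^-1 *: C1 = 0) <->
  [/\ C3 = 0, C2 = 0 & C1 = 0].
Proof.
split=> [H|[-> -> ->] x _]; last by rewrite !scaler0 !addr0.
have two0 : 2 != 0 :> K by rewrite pnatr_eq0.
have := H 1 (oner_neq0 _); rewrite !expr1n invr1 !scale1r => e1.
have := H (- 1); rewrite oppr_eq0 oner_neq0 => /(_ isT).
rewrite !exprS expr0 !mulr1 mulrNN mulr1 mulN1r invrN invr1 !scaleN1r scale1r.
move=> e2.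
have := H 2 two0 => e3.
have C2E : C2 = 0.
  apply: (can_inj (scalerK two0)); rewrite scaler0 scaler_nat mulr2n.
  by rewrite -[RHS](addr0 0) -{1}e1 -e2; mx_ring.
have C1E : C1 = - C3.
  by apply: subr0_eq; rewrite -[RHS]e1 C2E; mx_ring.
have C3E : C3 = 0.
  have q0 : (2 ^+ 3)^-1 - 2^-1 != 0 :> K.
    rewrite (_ : _ - _ = - 3 / 8); last by field.
    by rewrite mulf_neq0 ?oppr_eq0 ?invr_eq0 ?pnatr_eq0.
  apply: (can_inj (scalerK q0)); rewrite scaler0 -[RHS]e3 C1E C2E; mx_ring.
by rewrite C1E C3E oppr0.
Qed.

(** The coefficients are those of x^-3, x^-2 and x^-1 in the conjugated
    equation: the matrix [A2] of B is constant in the frame, and the term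
    [A2, A2] in x^-4 is zero. *)
Lemma curvature_conj n
    (A B : K -> K -> 'M[K]_n) (Gam A1 A0 : K -> 'M[K]_n)
    (A2 X dA1 dA0 : 'M[K]_n) (x t : K) :
  x != 0 -> Gam t \in unitmx ->
  is_derive t 1 Gam (X *m Gam t) ->
  is_derive t 1 A1 dA1 -> is_derive t 1 A0 dA0 ->
  (\forall s \near t, A x s = invmx (Gam s) *m ((x ^+ 3)^-1 *: A2
     + (x ^+ 2)^-1 *: A1 s + x^-1 *: A0 s) *m Gam s) ->
  (forall y, B y t = y^-1 *: (invmx (Gam t) *m A2 *m Gam t)) ->
  derive1 (A x) t - derive1 (B ^~ t) x + lie (A x t) (B x t) = invmx (Gam t) *m
    ((x ^+ 3)^-1 *: (lie A2 X + lie (A1 t) A2)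
     + (x ^+ 2)^-1 *: (dA1 + lie (A1 t) X + A2 + lie (A0 t) A2)
     + x^-1 *: (dA0 + lie (A0 t) X)) *m Gam t.
Proof.
move=> x0 uG dG dA1t dA0t AE BE.
set Ar := fun s => (x ^+ 3)^-1 *: A2 + (x ^+ 2)^-1 *: A1 s + x^-1 *: A0 s.
have dAr : is_derive t 1 Ar ((x ^+ 2)^-1 *: dA1 + x^-1 *: dA0).
  apply: (is_derive_eq (is_deriveD (is_deriveD
    (is_derive_cst ((x ^+ 3)^-1 *: A2) t 1)
    (is_deriveZ (x ^+ 2)^-1 dA1t)) (is_deriveZ x^-1 dA0t))).
  by rewrite add0r.
have [_ dA] : is_derive t 1 (A x)
    (invmx (Gam t) *m ((x ^+ 2)^-1 *: dA1 + x^-1 *: dA0 + lie (Ar t) X)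
       *m Gam t).
  apply: near_eq_is_derive (is_derive_conj dG dAr uG).
  by apply: filterS AE => s ->.
have [_ dB] : is_derive x 1 (B ^~ t)
    (- x ^- 2 *: (invmx (Gam t) *m A2 *m Gam t)).
  rewrite (_ : B ^~ t = fun y => y^-1 *: (invmx (Gam t) *m A2 *m Gam t)).
    exact/is_derive_scalemx/is_derive_inv.
  exact/funext.
rewrite !derive1E dA dB [in LHS]/lie (nbhs_singleton AE) BE.
have conjM (M N : 'M[K]_n) : (invmx (Gam t) *m M *m Gam t) *m
    (invmx (Gam t) *m N *m Gam t) = invmx (Gam t) *m (M *m N) *m Gam t.
  by rewrite !mulmxA mulmxK.
rewrite -!(scalemxAr, scalemxAl) -/(Ar t) !conjM.
(* With x^-n written as a power of x^-1, both sides are polynomials in x^-1. *)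
rewrite /lie /Ar -!exprVn.
mx_ring.
Qed.
End Curvature.

(** * The 2 x 2 matrices and the Hamiltonian *)

Section TwoByTwo.
Variable F : fieldType.
Implicit Types (a b c d : F).

Lemma mx2_eq a b c d a' b' c' d' :
  mx2 a b c d = mx2 a' b' c' d' <-> [/\ a = a', b = b', c = c' & d = d'].
Proof.
split=> [/matrixP E|[-> -> -> ->] //].
by split; [have := E 0 0|have := E 0 1|have := E 1 0|have := E 1 1];
  rewrite !mxE.
Qed.

Lemma mx2P (A B : 'M[F]_2) :
  A 0 0 = B 0 0 -> A 0 1 = B 0 1 -> A 1 0 = B 1 0 -> A 1 1 = B 1 1 -> A = B.
Proof.
move=> e00 e01 e10 e11; have ord2 (i : 'I_2) : i = 0 \/ i = 1.
  by case: i => -[|[|[]]] // ilt; [left|right]; apply: val_inj.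
by apply/matrixP => i j; case: (ord2 i) => ->; case: (ord2 j) => ->.
Qed.

Lemma addmx2 a b c d a' b' c' d' :
  mx2 a b c d + mx2 a' b' c' d' = mx2 (a + a') (b + b') (c + c') (d + d').
Proof. by apply: mx2P; rewrite !mxE. Qed.

Lemma oppmx2 a b c d : - mx2 a b c d = mx2 (- a) (- b) (- c) (- d).
Proof. by apply: mx2P; rewrite !mxE. Qed.

Lemma scalemx2 k a b c d :
  k *: mx2 a b c d = mx2 (k * a) (k * b) (k * c) (k * d).
Proof. by apply: mx2P; rewrite !mxE. Qed.

Lemma scalar_mx2 a : a%:M = mx2 a 0 0 a.
Proof. by apply: mx2P; rewrite !mxE. Qed.

Lemma mulmx2 a b c d a' b' c' d' :
  mx2 a b c d *m mx2 a' b' c' d' =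
  mx2 (a * a' + b * c') (a * b' + b * d') (c * a' + d * c') (c * b' + d * d').
Proof. by apply: mx2P; rewrite !mxE !big_ord_recl big_ord0 !mxE /= addr0. Qed.

Lemma trmx2 a b c d : \tr (mx2 a b c d) = a + d.
Proof. by rewrite /mxtrace !big_ord_recl big_ord0 !mxE /= addr0. Qed.

Definition mx2E :=
  (mulmx2, oppmx2, addmx2, scalemx2, scalar_mx2, trmx2).

Lemma diagmx2_unit a d : a != 0 -> d != 0 -> mx2 a 0 0 d \in unitmx.
Proof.
move=> a0 d0.
suff /mulmx1_unit[] : mx2 a 0 0 d *m mx2 a^-1 0 0 d^-1 = 1%:M by [].
by rewrite !mx2E !mulfV //; congr mx2; ring.
Qed.
End TwoByTwo.

Section Hamiltonian.
Variable K : numFieldType.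

Lemma derive1_quadratic (f : K -> K) (a b c x : K) :
  (forall y, f y = a * y ^+ 2 + b * y + c) -> derive1 f x = 2 * a * x + b.
Proof.
move=> fE.
have -> : f = a \*: (@id K ^+ 2) + b \*: @id K + cst c.
  by apply/funext => y; rewrite fE.
rewrite derive1E derive_val addr0 /GRing.scale /= expr1 !mulr1.
by ring.
Qed.

Lemma HamE (th0 th1 th2 q1 p1 q2 p2 t : K) :
  Ham th0 th1 th2 q1 p1 q2 p2 t =
  (p1 * q1 + 2 * p2 * q2 - (th0 + th1 + th2)) * (p1 / 2 - q1 - t)
  + (p1 / 2 - p2 * q1) * (p2 * q2 + q2 - (th0 + th1 + th2))
  - (q1 * (p2 * q2 - (th0 + th1 + th2)) - p1 * q2 / 2) * (p2 + 1)
  - (th0 + th1) * p1 + 2 * (th0 + 2 * th1 - 1) * q1.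
Proof. by rewrite /Ham /Pmx /Qmx !mx2E; field. Qed.

Variables th0 th1 th2 : K.
Variables q1 p1 q2 p2 t : K.
Local Notation c := (th0 + th1).
Local Notation k := (th0 + th1 + th2).
Local Notation H := (Ham th0 th1 th2).

(** H is at most quadratic in each variable separately. *)
Lemma derive1_Ham_p1 : derive1 (fun b1 => H q1 b1 q2 p2 t) p1 =
  p1 * q1 - q1 ^+ 2 - t * q1 + 2 * p2 * q2 + q2 - k - c.
Proof.
rewrite (derive1_quadratic (a := q1 / 2)
  (b := - q1 ^+ 2 - t * q1 + 2 * p2 * q2 + q2 - k - c) (c := H q1 0 q2 p2 t)).
  by field.
by move=> y; rewrite !HamE; field.
Qed.

Lemma derive1_Ham_q1 : derive1 (fun a1 => H a1 p1 q2 p2 t) q1 =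
  p1 * (p1 / 2 - q1 - t) - (p1 * q1 + 2 * p2 * q2 - k)
  - p2 * (p2 * q2 + q2 - k) - (p2 * q2 - k) * (p2 + 1)
  + 2 * (th0 + 2 * th1 - 1).
Proof.
rewrite (derive1_quadratic (a := - p1)
  (b := p1 * (p1 / 2 - t) - (2 * p2 * q2 - k)
  - p2 * (p2 * q2 + q2 - k) - (p2 * q2 - k) * (p2 + 1)
  + 2 * (th0 + 2 * th1 - 1)) (c := H 0 p1 q2 p2 t)).
  by field.
by move=> y; rewrite !HamE; field.
Qed.

Lemma derive1_Ham_p2 : derive1 (fun b2 => H q1 p1 q2 b2 t) p2 =
  2 * q2 * (p1 / 2 - q1 - t) - q1 * (p2 * q2 + q2 - k)
  + (p1 / 2 - p2 * q1) * q2 - q1 * q2 * (p2 + 1)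
  - (q1 * (p2 * q2 - k) - p1 * q2 / 2).
Proof.
rewrite (derive1_quadratic (a := - 2 * q1 * q2)
  (b := 2 * q2 * (p1 / 2 - q1 - t) - q1 * (q2 - k)
  + p1 / 2 * q2 - q1 * q2 + q1 * k + p1 * q2 / 2) (c := H q1 p1 q2 0 t)).
  by field.
by move=> y; rewrite !HamE; field.
Qed.

Lemma derive1_Ham_q2 : derive1 (fun a2 => H q1 p1 a2 p2 t) q2 =
  2 * p2 * (p1 / 2 - q1 - t) + (p1 - 2 * p2 * q1) * (p2 + 1).
Proof.
rewrite (derive1_quadratic (a := 0)
  (b := 2 * p2 * (p1 / 2 - q1 - t) + (p1 - 2 * p2 * q1) * (p2 + 1))
  (c := H q1 p1 0 p2 t)).
  by field.
by move=> y; rewrite !HamE; field.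
Qed.

(** The eight scalar equations are five: the equal diagonal entries give the
    same equation twice, for P by the Fuchs relation, and the lower left entry
    of the equation for P follows from the others. *)
Lemma hamiltonian_form (th3 dq1 dp1 dq2 dp2 w : K) :
  2 * th0 + 2 * th1 + th2 + th3 = 0 ->
  let Q := Qmx q1 q2 in
  let P := Pmx th0 th1 th2 p1 p2 q2 in
  let W2 := mx2 w 0 0 0 in
  (mx2 (dp1 / 2) (- dp2) (dp2 * q2 + p2 * dq2) (dp1 / 2)
     = lie W2 P + (2 *: Q + t%:M - P) *m P + (1 - th1)%:M + Thmx th2 th3 /\
   mx2 dq1 0 (- dq2) dq1
     = lie W2 Q + Q *m P + ((P - Q - t%:M) *m Q - th0%:M - th1%:M))
  <->
  [/\ [/\ dq1 = derive1 (fun b1 => H q1 b1 q2 p2 t) p1,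
          dp1 = - derive1 (fun a1 => H a1 p1 q2 p2 t) q1,
          dq2 = derive1 (fun b2 => H q1 p1 q2 b2 t) p2
        & dp2 = - derive1 (fun a2 => H q1 p1 a2 p2 t) q2]
    & w = 2 * (p2 + 1) * q1 - p1 + t].
Proof.
move=> Fuchs /=.
have -> : th3 = - (2 * th0 + 2 * th1 + th2).
  by apply: subr0_eq; rewrite -[RHS]Fuchs; ring.
rewrite derive1_Ham_p1 derive1_Ham_q1 derive1_Ham_p2 derive1_Ham_q2.
rewrite /lie /Qmx /Pmx /Thmx !mx2E !mx2_eq.
split=> [[[e11 e12 e21 e22] [f11 f12 f21 f22]]|[[-> -> -> ->] ->]]; last first.
  by split; split; field.
(* The upper right entry of the matrix of derivatives of Q is 0. *)
have wE : w = 2 * (p2 + 1) * q1 - p1 + t.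
  by apply: subr0_eq; rewrite [RHS]f12; field.
split=> //; split.
- by rewrite f11; field.
- by rewrite -[dp1](mulfVK (_ : 2 != 0)) ?pnatr_eq0 // e11; field.
- by rewrite -[dq2]opprK f21 wE; field.
- by rewrite -[dp2]opprK e12 wE; field.
Qed.
End Hamiltonian.

(** * Compatibility and Hamilton's equations *)

Section PainleveIV.
Variable K : numFieldType.

Lemma conj_intertwine n (T G L M : 'M[K]_n) :
  T \in unitmx -> G \in unitmx -> T *m L = M *m T ->
  invmx G *m L *m G = invmx (T *m G) *m M *m (T *m G).
Proof.
move=> uT uG TL; have uTG : T *m G \in unitmx by rewrite unitmx_mul uT.
rewrite -[RHS]mulmxA -[LHS](mulKmx uTG); congr (_ *m _).
by rewrite !mulmxA mulmxK // TL.
Qed.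

(** The lower left block of Gam' = X Gam: with Z = N^-1 S and U' = W1 U, the
    right-hand side is the derivative of Z U. *)
Lemma gauge_corner n (N S dS U W1 W2 : 'M[K]_n) :
  N \in unitmx -> N *m W2 = W2 *m N ->
  invmx N *m (dS + S *m W1 - W2 *m S) *m U + W2 *m (invmx N *m S *m U)
  = invmx N *m dS *m U + invmx N *m S *m (W1 *m U).
Proof.
move=> uN N_W2; have VN_W2 : W2 *m invmx N = invmx N *m W2.
  by rewrite -[LHS](mulKmx uN); congr (_ *m _); rewrite mulmxA N_W2 mulmxK.
rewrite !mulmxA VN_W2; mx_ring.
Qed.

Lemma conj_eq0 n (G M : 'M[K]_n) :
  G \in unitmx -> invmx G *m M *m G = 0 <-> M = 0.
Proof.
move=> uG; split=> [E|->]; last by rewrite mulmx0 mul0mx.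
by rewrite -[LHS](mulKVmx uG) -[invmx G *m M](mulmxK uG) E mul0mx mulmx0.
Qed.

Lemma shear_unit n (Z : 'M[K]_n) : shear Z \in unitmx.
Proof. by rewrite unitmxE det_lblock !det1 mulr1 unitr1. Qed.

Lemma Gmx_unit (U : 'M[K]_2) v : U \in unitmx -> v != 0 -> Gmx U v \in unitmx.
Proof.
move=> uU v0; rewrite unitmxE det_lblock unitrM -!unitmxE uU.
by rewrite diagmx2_unit ?oner_neq0.
Qed.

Lemma is_derive_mx2 (a b c d : K -> K) (x da db dc dd : K) :
  is_derive x 1 a da -> is_derive x 1 b db ->
  is_derive x 1 c dc -> is_derive x 1 d dd ->
  is_derive x 1 (fun s => mx2 (a s) (b s) (c s) (d s)) (mx2 da db dc dd).
Proof.
move=> Da Db Dc Dd; apply/is_derive_mxP => i j; rewrite mxE.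
under eq_fun do rewrite mxE.
by case: ifP => _; case: ifP.
Qed.

Lemma is_derive_scalar_mx n (x : K) :
  is_derive x 1 (fun s : K => s%:M : 'M[K]_n) 1%:M.
Proof.
apply/is_derive_mxP => i j; rewrite mxE.
rewrite (_ : (fun s => _) = fun s => s *+ (i == j)); last first.
  by apply/funext => s; rewrite mxE.
by case: (i == j); [exact: is_derive_id|exact: is_derive_cst].
Qed.

Lemma Umx_gauge (th0 th1 th2 q1 p1 q2 p2 t w : K) :
  w = 2 * (p2 + 1) * q1 - p1 + t ->
  mx2 w 0 0 0 + 2 *: Qmx q1 q2 + t%:M - Pmx th0 th1 th2 p1 p2 q2
  = Umx th0 th1 th2 q1 p1 q2 p2 t.
Proof. by move=> ->; rewrite /Qmx /Pmx /Umx !mx2E; congr mx2; field. Qed.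

Lemma derivable1E (W : normedModType K) (f : K -> W) (t : K) :
  derivable f t 1 -> is_derive t 1 f (derive1 f t).
Proof. by rewrite derive1E => /derivableP. Qed.

Variables th0 th1 th2 th3 : K.
Variables (q1 p1 q2 p2 v : K -> K) (U : K -> 'M[K]_2) (t : K).
Hypotheses (Fuchs : 2 * th0 + 2 * th1 + th2 + th3 = 0)
  (th12 : th1 != th2) (th13 : th1 != th3).
Hypotheses (q1d : derivable q1 t 1) (p1d : derivable p1 t 1)
  (q2d : derivable q2 t 1) (p2d : derivable p2 t 1)
  (vd : derivable v t 1) (Ud : derivable U t 1).
Hypotheses (v0 : \forall s \near t, v s != 0)
  (uU : \forall s \near t, U s \in unitmx).

Let A x s := Amx th0 th1 th2 th3 (q1 s) (p1 s) (q2 s) (p2 s) (v s) (U s) x s.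
Let B x s := Bmx th0 th1 th2 th3 (q1 s) (p1 s) (q2 s) (p2 s) (v s) (U s) x s.
Let H a1 b1 a2 b2 s := Ham th0 th1 th2 a1 b1 a2 b2 s.

Let dq1 := derive1 q1 t.
Let dp1 := derive1 p1 t.
Let dq2 := derive1 q2 t.
Let dp2 := derive1 p2 t.
Let dv := derive1 v t.
Let dU := derive1 U t.

Let Q s := Qmx (q1 s) (q2 s).
Let P s := Pmx th0 th1 th2 (p1 s) (p2 s) (q2 s).
Let Th := Thmx th2 th3.
Let N := th1%:M - Th.
Let S s := (P s - Q s - s%:M) *m Q s - th0%:M - th1%:M.
Let Z s := invmx N *m S s.
Let Gam s := shear (Z s) *m Gmx (U s) (v s).

Let dQ := mx2 dq1 0 (- dq2) dq1.
Let dP := mx2 (dp1 / 2) (- dp2) (dp2 * q2 t + p2 t * dq2) (dp1 / 2).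
Let dS := (dP - dQ - 1%:M) *m Q t + (P t - Q t - t%:M) *m dQ.

(* The blocks of X are those of Gam' Gam^-1; since N Z = S and N commutes with
   W2, the corner N^-1 (S' + S W1 - W2 S) is Z' + Z W1 - W2 Z. *)
Let W1 := dU *m invmx (U t).
Let W2 := mx2 (dv / v t) 0 0 0.
Let corner := invmx N *m (dS + S t *m W1 - W2 *m S t).
Let X := block_mx W1 0 corner W2.

Let uN : N \in unitmx.
Proof.
rewrite /N /Th /Thmx !mx2E !(oppr0, addr0).
by apply: diagmx2_unit; rewrite subr_eq0.
Qed.

Let Th_W2 : Th *m W2 = W2 *m Th.
Proof. by rewrite /Th /W2 /Thmx !mx2E; congr mx2; ring. Qed.

Let is_derive_Q : is_derive t 1 Q dQ.
Proof.
exact: (is_derive_mx2 (derivable1E q1d) (is_derive_cst (1 : K) t 1)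
  (is_deriveN (derivable1E q2d)) (derivable1E q1d)).
Qed.

Let is_derive_P : is_derive t 1 P dP.
Proof.
have half (f : K -> K) : derivable f t 1 ->
    is_derive t 1 (fun s => f s / 2) (derive1 f t / 2).
  move=> /derivable1E Df.
  apply: (is_derive_eq (is_deriveM Df (is_derive_cst (2^-1 : K) t 1))).
  by rewrite scaler0 add0r /GRing.scale /= mulrC.
have D21 : is_derive t 1 (fun s => p2 s * q2 s - th0 - th1 - th2)
    (dp2 * q2 t + p2 t * dq2).
  apply: (is_derive_eq (is_deriveB (is_deriveB (is_deriveB
    (is_deriveM (derivable1E p2d) (derivable1E q2d))
    (is_derive_cst th0 t 1)) (is_derive_cst th1 t 1)) (is_derive_cst th2 t 1))).
  by rewrite !subr0 addrC /GRing.scale /= [q2 t * _]mulrC.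
exact: is_derive_mx2 (half _ p1d) (is_deriveN (derivable1E p2d)) D21
  (half _ p1d).
Qed.

Let is_derive_S : is_derive t 1 S dS.
Proof.
apply: (is_derive_eq (is_deriveB (is_deriveB (is_derive_mulmx
  (is_deriveB (is_deriveB is_derive_P is_derive_Q) (is_derive_scalar_mx 2 t))
  is_derive_Q)
  (is_derive_cst (th0%:M : 'M[K]_2) t 1))
  (is_derive_cst (th1%:M : 'M[K]_2) t 1))).
by rewrite !subr0.
Qed.

Let is_derive_Z : is_derive t 1 Z (invmx N *m dS).
Proof.
apply: (is_derive_eq
  (is_derive_mulmx (is_derive_cst (invmx N) t 1) is_derive_S)).
by rewrite mul0mx add0r.
Qed.

Let Gam_unit : \forall s \near t, Gam s \in unitmx.
Proof.
apply: filterS2 v0 uU => s vs uUs.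
by rewrite unitmx_mul shear_unit Gmx_unit.
Qed.

Let GamE s : Gam s = block_mx (U s) 0 (Z s *m U s) (mx2 (v s) 0 0 1).
Proof.
by rewrite /Gam /shear /Gmx mulmx_block !(mul1mx, mul0mx, mulmx0, addr0, add0r).
Qed.

Let is_derive_Gam : is_derive t 1 Gam (X *m Gam t).
Proof.
rewrite (_ : Gam = fun s => block_mx (U s) 0 (Z s *m U s) (mx2 (v s) 0 0 1));
  last exact/funext.
have uUt := nbhs_singleton uU; have vt := nbhs_singleton v0.
have DU : is_derive t 1 U (W1 *m U t).
  by rewrite /W1 mulmxKV //; exact: derivable1E.
apply: (is_derive_eq (is_derive_block DU (is_derive_cst (0 : 'M[K]_2) t 1)
  (is_derive_mulmx is_derive_Z DU)
  (is_derive_mx2 (derivable1E vd) (is_derive_cst (0 : K) t 1)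
    (is_derive_cst (0 : K) t 1)
    (is_derive_cst (1 : K) t 1)))).
have N_W2 : N *m W2 = W2 *m N.
  by rewrite /N mulmxBl mulmxBr Th_W2 scalar_mxC.
rewrite mulmx_block !(mul0mx, mulmx0, addr0, add0r); congr block_mx.
  exact/esym/gauge_corner.
by rewrite /W2 !mx2E !(mul0r, mulr0, addr0) divfK.
Qed.

Let A_reduced x : \forall s \near t, A x s =
  invmx (Gam s) *m ((x ^+ 3)^-1 *: redA2 K 2
    + (x ^+ 2)^-1 *: redA1 (Q s) (P s) s + x^-1 *: redA0 th1 Th (S s)) *m Gam s.
Proof.
apply: filterS2 v0 uU => s vs uUs.
apply: conj_intertwine; rewrite ?shear_unit ?Gmx_unit //.
rewrite !mulmxDr !mulmxDl -!scalemxAr -!scalemxAl.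
rewrite shear_hatA2 shear_hatA1 (@shear_hatA0 _ _ _ (S s)) //.
by rewrite mulKVmx.
Qed.

Lemma curvature_PIV :
  (forall x, x != 0 ->
     derive1 (A x) t - derive1 (B ^~ t) x + lie (A x t) (B x t) = 0) <->
  [/\ [/\ dq1 = derive1 (fun b1 => H (q1 t) b1 (q2 t) (p2 t) t) (p1 t),
          dp1 = - derive1 (fun a1 => H a1 (p1 t) (q2 t) (p2 t) t) (q1 t),
          dq2 = derive1 (fun b2 => H (q1 t) (p1 t) (q2 t) b2 t) (p2 t)
        & dp2 = - derive1 (fun a2 => H (q1 t) (p1 t) a2 (p2 t) t) (q2 t)],
      dU = Umx th0 th1 th2 (q1 t) (p1 t) (q2 t) (p2 t) t *m U t
    & (v t)^-1 * dv = 2 * (p2 t + 1) * q1 t - p1 t + t].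
Proof.
have uG := nbhs_singleton Gam_unit.
have uUt := nbhs_singleton uU.
have dA1 : is_derive t 1 (fun s => redA1 (Q s) (P s) s)
    (block_mx (dQ + 1%:M) dP (- dQ) (- dQ)).
  exact: is_derive_block (is_deriveD is_derive_Q (is_derive_scalar_mx 2 t))
    is_derive_P (is_deriveN is_derive_Q) (is_deriveN is_derive_Q).
have dA0 : is_derive t 1 (fun s => redA0 th1 Th (S s))
    (block_mx 0 0 (- dS) 0).
  have := is_deriveN (is_derive_block (is_derive_cst (th1%:M : 'M[K]_2) t 1)
    (is_derive_cst (0 : 'M[K]_2) t 1) is_derive_S (is_derive_cst Th t 1)).
  by move=> /is_derive_eq; apply; rewrite opp_block_mx oppr0.
have BE y : B y t = y^-1 *: (invmx (Gam t) *m redA2 K 2 *m Gam t).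
  congr (_ *: _); apply: conj_intertwine; first exact: shear_unit.
    by apply: Gmx_unit => //; exact: nbhs_singleton v0.
  exact: shear_hatA2.
have curvE x (x0 : x != 0) := curvature_conj x0 uG is_derive_Gam dA1 dA0
  (A_reduced x) BE.
have cornerE : N *m corner = dS + S t *m W1 - W2 *m S t by rewrite mulKVmx.
have resE := reduced_residue Th_W2 cornerE.
have SE : S t = (P t - Q t - t%:M) *m Q t - (th0 + th1)%:M.
  by rewrite raddfD opprD addrA.
have hamE := hamiltonian_form (q1 t) (p1 t) (q2 t) (p2 t) t dq1 dp1 dq2 dp2
  (dv / v t) Fuchs.
split=> [E|[ham dUE vE]].
  have /laurent_eq0[e3 e2 _] x : x != 0 -> _ := fun x0 =>
    (conj_eq0 _ uG).1 (etrans (esym (curvE x x0)) (E x x0)).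
  have [_ W1E dPE dQE] :=
    (reduced_curvature _ _ _ _ _ _ _ _ _ _ _).1 (conj e3 e2).
  have [ham wE] := hamE.1 (conj dPE dQE).
  split=> //; last by rewrite mulrC.
  by rewrite -(Umx_gauge _ _ _ _ wE) -W1E mulmxKV.
have wE : dv / v t = 2 * (p2 t + 1) * q1 t - p1 t + t by rewrite mulrC.
have [dPE dQE] := hamE.2 (conj ham wE).
have W1E : W1 = W2 + 2 *: Q t + t%:M - P t.
  by rewrite (Umx_gauge _ _ _ _ wE) -[RHS](mulmxK uUt) -dUE.
have KE := reduced_corner uN Th_W2 cornerE SE erefl W1E dPE dQE.
have [e3 e2] := (reduced_curvature _ _ _ _ _ _ _ _ _ _ _).2
  (And4 KE W1E dPE dQE).
move=> x x0; rewrite curvE //; apply/conj_eq0 => //.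
by move: x x0; apply/laurent_eq0; split.
Qed.
End PainleveIV.

Theorem mainTheorem3 (R : realType) (th0 th1 th2 th3 : Cplx R)
    (D : set (Cplx R)) (q1 p1 q2 p2 v : Cplx R -> Cplx R)
    (U : Cplx R -> 'M[Cplx R]_2)
    (Fuchs : 2 * th0 + 2 * th1 + th2 + th3 = 0)
    (th12 : th1 != th2) (th13 : th1 != th3) (th23 : th2 != th3)
    (D_open : open D) (D_connected : connected D) (D_nonempty : D !=set0)
    (q1_hol : holomorphic_on D q1) (p1_hol : holomorphic_on D p1)
    (q2_hol : holomorphic_on D q2) (p2_hol : holomorphic_on D p2)
    (v_hol : holomorphic_on D v) (U_hol : holomorphic_on D U)
    (v_neq0 : forall t, D t -> v t != 0)
    (U_det : forall t, D t -> \det (U t) != 0) :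
  let A x t :=
    Amx th0 th1 th2 th3 (q1 t) (p1 t) (q2 t) (p2 t) (v t) (U t) x t in
  let B x t :=
    Bmx th0 th1 th2 th3 (q1 t) (p1 t) (q2 t) (p2 t) (v t) (U t) x t in
  let H a1 b1 a2 b2 t := Ham th0 th1 th2 a1 b1 a2 b2 t in
  (forall t x : Cplx R, D t -> x != 0 -> zero_curvature A B x t = 0)
  <->
  (forall t : Cplx R, D t ->
    [/\ [/\ derive1 q1 t
             = derive1 (fun b1 => H (q1 t) b1 (q2 t) (p2 t) t) (p1 t),
            derive1 p1 t
             = - derive1 (fun a1 => H a1 (p1 t) (q2 t) (p2 t) t) (q1 t),
            derive1 q2 t
             = derive1 (fun b2 => H (q1 t) (p1 t) (q2 t) b2 t) (p2 t)
          & derive1 p2 t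
             = - derive1 (fun a2 => H (q1 t) (p1 t) a2 (p2 t) t) (q2 t)],
        derive1 U t = Umx th0 th1 th2 (q1 t) (p1 t) (q2 t) (p2 t) t *m U t
      & (v t)^-1 * derive1 v t = 2 * (p2 t + 1) * q1 t - p1 t + t]).
Proof.
move=> A B H.
have near_D (t : Cplx R) : D t -> \forall s \near t, D s.
  by move=> Dt; exact: open_nbhs_nbhs.
have near_v (t : Cplx R) : D t -> \forall s \near t, v s != 0.
  by move=> Dt; apply: filterS (near_D t Dt) => s; exact: v_neq0.
have near_U (t : Cplx R) : D t -> \forall s \near t, U s \in unitmx.
  move=> Dt; apply: filterS (near_D t Dt) => s Ds.
  by rewrite unitmxE unitfE; exact: U_det.
have pointwise t (Dt : D t) := curvature_PIV Fuchs th12 th13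
  (q1_hol t Dt) (p1_hol t Dt) (q2_hol t Dt) (p2_hol t Dt) (v_hol t Dt)
  (U_hol t Dt) (near_v t Dt) (near_U t Dt).
split=> [E t Dt|E t x Dt x0].
  by apply: (pointwise t Dt).1 => x; exact: E.
exact: (pointwise t Dt).2 (E t Dt) x x0.
Qed.
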